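(* Let $n\ge0$ be an integer and $x>0$. Then $$I_1^{\ast}\left(\frac n2,\frac{n+1}{2};x\right)=\frac{e^{x}\,\mathrm{Ein}(x)}{x^{n+1}}\,\Gamma(n+1,x)+n!\sum_{k=0}^{n}\frac{x^{-k-1}}{(n-k)!}\left\{(-1)^{k+1}\Gamma(-k,x)\,\gamma(k+1,-x)-H_k-\sum_{\ell=1}^{k}\binom{k}{\ell}(-x)^{-\ell}\gamma(\ell,x)\right\}.$$
   Context: For $x>0$ and $\mathrm{Re}(\mu-\kappa)>-\frac12$, define $I_1^{\ast}(\kappa,\mu;x)=\int_0^\infty e^{-xt}\,t^{\mu-\kappa-1/2}(1+t)^{\mu+\kappa-1/2}\ln\left(\frac{1+t}{t}\right)dt$. $\gamma(\nu,z)=\int_0^z t^{\nu-1}e^{-t}\,dt$ ($\mathrm{Re}\,\nu>0$) and $\Gamma(\nu,z)=\int_z^\infty t^{\nu-1}e^{-t}\,dt$ are the lower and upper incomplete gamma functions. $\mathrm{Ein}(z)=\int_0^z\frac{1-e^{-t}}{t}\,dt$ is the complementary exponential integral. $H_k=\sum_{j=1}^k\frac1j$ is the $k$-th harmonic number ($H_0=0$). *)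

(* Defs.v *)
From Stdlib Require Import Reals ZArith.
From Coquelicot Require Import Coquelicot.
Open Scope R_scope.

(* [RInt] is the oriented Riemann
   integral and [RInt_gen] the improper one; both are total, and return an
   unspecified value when the integral does not converge. *)

(* For real [kappa], [mu] with [mu - kappa > -1/2], and [x > 0].  The
   integrand may be singular at [0], hence the one-sided filter there. *)
Definition I1star (kappa mu x : R) : R :=
  RInt_gen
    (fun t => exp (- (x * t)) * Rpower t (mu - kappa - 1 / 2)
              * Rpower (1 + t) (mu + kappa - 1 / 2) * ln ((1 + t) / t))
    (at_right 0) (Rbar_locally p_infty).

(* The incomplete gamma functions at integer order.  The order is in [Z]
   because [Rpower] has no meaning on a negative base, while [t ^ (nu - 1)]
   with integer [nu] is single-valued there: [z] may then be negative. *)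
Definition lower_gamma (nu : Z) (z : R) : R :=
  RInt (fun t => powerRZ t (nu - 1) * exp (- t)) 0 z.

(* For [z > 0]; the order may be zero or negative. *)
Definition upper_gamma (nu : Z) (z : R) : R :=
  RInt_gen (fun t => powerRZ t (nu - 1) * exp (- t))
    (at_point z) (Rbar_locally p_infty).

(* The value of the integrand at the single point [0] is irrelevant. *)
Definition Ein (z : R) : R := RInt (fun t => (1 - exp (- t)) / t) 0 z.

(* [sum_n_m a 1 0] is the empty sum, unlike [sum_f 1 0]. *)
Definition harmonic (k : nat) : R := sum_n_m (fun j => / INR j) 1 k.

(* Main.v *)
Require Import Defs.
From Stdlib Require Import Reals ZArith Lra Lia.
From Coquelicot Require Import Coquelicot.
Open Scope R_scope.

(** Put [J n] for the integral of [exp (- x t) (1 + t)^n ln ((1 + t) / t)] over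
    the positive half-line and [A n] for that of
    [(1 - (1 + t)^n exp (- x t)) / (t (1 + t))].  Integrating by parts against
    [1 - (1 + t)^n exp (- x t)] gives [x J_n = n J_(n-1) + A_n].  Moreover
    [A_0 = Ein x + (e^x - 1) Gamma(0, x)] and
    [A_(n+1) = A_n - e^x x^(-n) Gamma(n, x)].  If [C_k] denotes the expression in
    braces, the recurrences of the incomplete gamma functions and Pascal's rule give
    [C_(k+1) - C_k = - x^(k+1) e^x Gamma(-k, x) / (k + 1)].  The right-hand side of
    the theorem is [n!] times the convolution of [x^(-k-1) (Ein x + C_k)] with
    [1 / k!], and it satisfies the recurrence of [J] because
    [n! sum_k Gamma(-k, x) / (n - k)! = x^(-n) Gamma(n, x)]. *)

(** * Improper integrals over the positive half-line, zero derivatives and monotone limits *)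

Lemma filter_prod_pos (P : R -> Prop) :
  (forall t, 0 < t -> P t) ->
  filter_prod (at_right 0) (Rbar_locally p_infty)
    (fun ab : R * R =>
       forall t, Rmin (fst ab) (snd ab) <= t <= Rmax (fst ab) (snd ab) -> P t).
Proof.
  intros HP.
  apply Filter_prod with (Q := fun a => 0 < a) (R := fun b => 0 < b).
  - exists (mkposreal 1 Rlt_0_1); intros a _ Ha; exact Ha.
  - exists 0; intros b Hb; exact Hb.
  - intros a b Ha Hb t Ht; simpl in Ht; apply HP.
    apply Rlt_le_trans with (2 := proj1 Ht); apply Rmin_glb_lt; assumption.
Qed.

Lemma is_RInt_gen_ext_pos (f g : R -> R) (l : R) :
  (forall t, 0 < t -> f t = g t) ->
  is_RInt_gen f (at_right 0) (Rbar_locally p_infty) l ->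
  is_RInt_gen g (at_right 0) (Rbar_locally p_infty) l.
Proof.
  intros H; apply is_RInt_gen_ext.
  generalize (filter_prod_pos _ H); apply filter_imp.
  intros ab Hab t Ht; apply Hab; lra.
Qed.

(** The fundamental theorem of calculus on the open half-line. Only a one-sided limit of [F] at 0 is
    asked for, so [F] may involve a logarithm that is singular there; convergence comes together
    with the value. *)
Lemma is_RInt_gen_antiderivative (F f : R -> R) (la lb : R) :
  (forall t, 0 < t -> is_derive F t (f t)) ->
  (forall t, 0 < t -> continuous f t) ->
  filterlim F (at_right 0) (locally la) ->
  filterlim F (Rbar_locally p_infty) (locally lb) ->
  is_RInt_gen f (at_right 0) (Rbar_locally p_infty) (lb - la).
Proof.
  intros HD HC Ha Hb.
  assert (HE : forall t, 0 < t -> Derive F t = f t)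
    by (intros t Ht; apply is_derive_unique; auto).
  apply is_RInt_gen_ext_pos with (Derive F); [exact HE|].
  apply is_RInt_gen_Derive; auto; apply filter_prod_pos; intros t Ht.
  - exists (f t); auto.
  - apply continuous_ext_loc with f; [|auto].
    exists (mkposreal t Ht); intros s Hs; symmetry; apply HE.
    apply Rabs_def2 in Hs; unfold minus, plus, opp in Hs; simpl in Hs; lra.
Qed.

Lemma is_derive_continuous (f : R -> R) (t l : R) :
  is_derive f t l -> continuous f t.
Proof. intros H; apply (ex_derive_continuous (V := R_NormedModule)); exists l; exact H. Qed.

(** Mean value theorem. Identities between special functions are proved below by differentiating the
    difference of the two sides and evaluating it at one point or at infinity. *)
Lemma zero_derive_pos (f : R -> R) :
  (forall t, 0 < t -> is_derive f t 0) ->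
  forall a b, 0 < a -> 0 < b -> f a = f b.
Proof.
  intros HD a b Ha Hb.
  destruct (MVT_gen f a b (fun _ => 0)) as [c [_ Hc]].
  - intros t Ht; apply HD.
    apply Rlt_trans with (2 := proj1 Ht); apply Rmin_glb_lt; assumption.
  - intros t Ht; apply derivable_continuous_pt; exists 0; apply is_derive_Reals, HD.
    apply Rlt_le_trans with (2 := proj1 Ht); apply Rmin_glb_lt; assumption.
  - lra.
Qed.

Lemma zero_derive_eq (f : R -> R) :
  (forall t, is_derive f t 0) -> forall a b, f a = f b.
Proof.
  intros HD a b.
  destruct (MVT_gen f a b (fun _ => 0)) as [c [_ Hc]].
  - intros t _; apply HD.
  - intros t _; apply derivable_continuous_pt; exists 0; apply is_derive_Reals, HD.
  - lra.
Qed.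

Lemma increasing_bounded_lim (F : R -> R) (a M : R) :
  (forall s t, a <= s -> s <= t -> F s <= F t) ->
  (forall t, a <= t -> F t <= M) ->
  exists l, filterlim F (Rbar_locally p_infty) (locally l).
Proof.
  intros Hinc HM.
  destruct (completeness (fun y => exists t, a <= t /\ y = F t)) as [l [Hub Hlub]].
  - exists M; intros y [t [Ht ->]]; auto.
  - exists (F a), a; split; [lra|reflexivity].
  - exists l; apply filterlim_locally; intros eps.
    (* Otherwise [l - eps] would be an upper bound smaller than the supremum [l]. *)
    assert (Hs : exists s, a <= s /\ l - eps < F s).
    { destruct (Classical_Prop.classic (exists s, a <= s /\ l - eps < F s))
        as [H|H]; [exact H|exfalso].
      assert (l <= l - eps); [|destruct eps as [e He]; simpl in *; lra].
      apply Hlub; intros y [t [Ht ->]].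
      apply Rnot_lt_le; intros H'; apply H; exists t; auto. }
    destruct Hs as [s [Hs1 Hs2]].
    exists s; intros t Ht.
    assert (F t <= l) by (apply Hub; exists t; split; [lra|reflexivity]).
    assert (F s <= F t) by (apply Hinc; lra).
    apply Rabs_def1; unfold minus, plus, opp; simpl; destruct eps as [e He]; simpl in *; lra.
Qed.

(** * The upper incomplete gamma function *)

Lemma is_derive_powerRZ (m : Z) (t : R) :
  0 < t -> is_derive (fun s => powerRZ s m) t (IZR m * powerRZ t (m - 1)).
Proof.
  intros Ht.
  assert (H1 : powerRZ t (m - 1) = powerRZ t m / t).
  { unfold Z.sub; rewrite powerRZ_add by lra; simpl; rewrite Rmult_1_r; reflexivity. }
  rewrite H1; clear H1.
  destruct (Z_le_gt_dec 0 m) as [Hm|Hm].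
  - rewrite <- (Z2Nat.id m Hm); set (n := Z.to_nat m).
    apply (is_derive_ext (fun s => s ^ n)); [intros s; apply pow_powerRZ|].
    rewrite <- INR_IZR_INZ, <- pow_powerRZ.
    auto_derive; [exact I|].
    destruct n as [|k]; [simpl; field; lra|].
    simpl pred; rewrite <- tech_pow_Rmult; field; lra.
  - replace m with (- Z.of_nat (Z.to_nat (- m)))%Z by lia.
    set (n := Z.to_nat (- m)).
    assert (Hn : t ^ n <> 0) by (apply pow_nonzero; lra).
    apply (is_derive_ext (fun s => / s ^ n)).
    { intros s; rewrite powerRZ_neg', <- pow_powerRZ; reflexivity. }
    rewrite opp_IZR, <- INR_IZR_INZ, powerRZ_neg', <- pow_powerRZ.
    auto_derive; [exact Hn|].
    destruct n as [|k]; [simpl; field; lra|].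
    assert (t ^ k <> 0) by (apply pow_nonzero; lra).
    simpl pred; rewrite <- tech_pow_Rmult; field; split; [assumption|lra].
Qed.

Definition gamma_integrand (m : Z) (t : R) : R := powerRZ t (m - 1) * exp (- t).

Lemma gamma_integrand_continuous (m : Z) (t : R) :
  0 < t -> continuous (gamma_integrand m) t.
Proof.
  intros Ht; apply (continuous_mult (fun s => powerRZ s (m - 1)) (fun s => exp (- s))).
  - eapply is_derive_continuous, is_derive_powerRZ, Ht.
  - apply (ex_derive_continuous (V := R_NormedModule)); auto_derive; auto.
Qed.

(** A single Taylor term [t ^ k / k!] bounds [exp t] from below. The square in the denominator makes
    the bound integrable at infinity, and it also yields decay to 0. *)
Lemma powerRZ_exp_bound (m : Z) :
  exists C, forall t, 1 <= t -> 0 <= powerRZ t m * exp (- t) <= C / t ^ 2.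
Proof.
  (* [Z.to_nat] returns 0 when [m + 2] is negative; then [t ^ (m + 2) <= 1] for [t >= 1] is
     enough. *)
  set (k := Z.to_nat (m + 2)).
  exists (INR (fact k)); intros t Ht.
  assert (Hm : powerRZ t m * t ^ 2 <= t ^ k).
  { rewrite 2!pow_powerRZ, <- powerRZ_add by lra.
    unfold k; destruct (Z_le_gt_dec 0 (m + 2)) as [H|H].
    - rewrite Z2Nat.id by lia; apply Req_le; f_equal; lia.
    - replace (Z.to_nat (m + 2)) with 0%nat by lia; simpl (powerRZ _ (Z.of_nat 0)).
      replace (m + Z.of_nat 2)%Z with (- Z.of_nat (Z.to_nat (- (m + 2))))%Z by lia.
      rewrite powerRZ_neg', <- pow_powerRZ, <- Rinv_1.
      apply Rinv_le_contravar; [lra|]; apply pow_R1_Rle, Ht. }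
  assert (He : t ^ k / INR (fact k) <= exp t).
  { apply Rle_trans with (2 := exp_ge_taylor t k ltac:(lra)).
    destruct k as [|k]; [simpl; lra|].
    rewrite tech5.
    assert (0 <= sum_f_R0 (fun i => t ^ i / INR (fact i)) k); [|lra].
    apply cond_pos_sum; intros i.
    apply Rdiv_le_0_compat; [apply pow_le; lra|apply INR_fact_lt_0]. }
  assert (Hf := INR_fact_lt_0 k).
  assert (H2 : 0 < t ^ 2) by (apply pow_lt; lra).
  split.
  - apply Rmult_le_pos; [apply powerRZ_le; lra|left; apply exp_pos].
  - rewrite exp_Ropp; apply Rle_div_l in He; [|exact Hf].
    apply Rmult_le_reg_r with (1 := H2).
    replace (INR (fact k) / t ^ 2 * t ^ 2) with (INR (fact k)) by (field; lra).
    replace (powerRZ t m * / exp t * t ^ 2) with (powerRZ t m * t ^ 2 / exp t)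
      by (unfold Rdiv; ring).
    apply Rle_div_l; [apply exp_pos|lra].
Qed.

Lemma filterlim_Rplus {T : Type} (F : (T -> Prop) -> Prop) {FF : Filter F}
  (f g : T -> R) (a b : R) :
  filterlim f F (locally a) -> filterlim g F (locally b) ->
  filterlim (fun t => f t + g t) F (locally (a + b)).
Proof.
  intros Hf Hg; eapply filterlim_comp_2; [exact Hf|exact Hg|].
  exact (filterlim_plus (K := R_AbsRing) (V := R_NormedModule) a b).
Qed.

Lemma filterlim_Rmult {T : Type} (F : (T -> Prop) -> Prop) {FF : Filter F}
  (f g : T -> R) (a b : R) :
  filterlim f F (locally a) -> filterlim g F (locally b) ->
  filterlim (fun t => f t * g t) F (locally (a * b)).
Proof.
  intros Hf Hg; eapply filterlim_comp_2; [exact Hf|exact Hg|].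
  exact (filterlim_mult (K := R_AbsRing) a b).
Qed.

Lemma filterlim_squeeze_0 {T : Type} (F : (T -> Prop) -> Prop) {FF : Filter F}
  (f g : T -> R) :
  F (fun t => Rabs (f t) <= g t) ->
  filterlim g F (locally 0) -> filterlim f F (locally 0).
Proof.
  intros Hfg Hg; apply filterlim_locally; intros eps.
  assert (H := proj1 (filterlim_locally g 0) Hg eps).
  generalize (filter_and _ _ Hfg H); apply filter_imp; intros t [H1 H2].
  unfold ball in *; simpl in *; unfold AbsRing_ball, abs, minus, plus, opp in *; simpl in *.
  apply Rabs_def2 in H2; replace (f t + - 0) with (f t) by ring; lra.
Qed.

Lemma filterlim_div_p_infty (c : R) :
  filterlim (fun t => c / t) (Rbar_locally p_infty) (locally 0).
Proof.
  replace 0 with (c * 0) by ring.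
  apply (filterlim_Rmult (Rbar_locally p_infty)); [apply filterlim_const|].
  exact (filterlim_Rbar_inv p_infty ltac:(discriminate)).
Qed.

Lemma powerRZ_exp_lim (m : Z) :
  filterlim (fun t => powerRZ t m * exp (- t)) (Rbar_locally p_infty) (locally 0).
Proof.
  destruct (powerRZ_exp_bound m) as [C HC].
  apply (filterlim_squeeze_0 (Rbar_locally p_infty)) with (fun t => C / t); [|apply filterlim_div_p_infty].
  exists 1; intros t Ht.
  destruct (HC t ltac:(lra)) as [H1 H2].
  rewrite Rabs_pos_eq by exact H1; apply Rle_trans with (1 := H2).
  replace (C / t) with (C / t ^ 2 * t) by (field; lra); nra.
Qed.

Lemma is_RInt_inv_sqr (a b : R) :
  0 < a -> a <= b -> is_RInt (fun t => / t ^ 2) a b (/ a - / b).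
Proof.
  intros Ha Hab.
  replace (/ a - / b) with (minus (- / b) (- / a)) by (unfold minus, plus, opp; simpl; ring).
  apply (is_RInt_derive (V := R_CompleteNormedModule) (fun t => - / t)).
  - intros t Ht; rewrite Rmin_left in Ht by lra; auto_derive; [lra|simpl; field; lra].
  - intros t Ht; rewrite Rmin_left in Ht by lra.
    apply (ex_derive_continuous (V := R_NormedModule)); auto_derive.
    apply Rgt_not_eq; nra.
Qed.

Lemma ex_RInt_gamma_integrand (m : Z) (a b : R) :
  0 < a -> 0 < b -> ex_RInt (gamma_integrand m) a b.
Proof.
  intros Ha Hb; apply (ex_RInt_continuous (V := R_CompleteNormedModule)).
  intros t Ht; apply gamma_integrand_continuous.
  apply Rlt_le_trans with (2 := proj1 Ht); apply Rmin_glb_lt; assumption.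
Qed.

Lemma gamma_integrand_pos (m : Z) (t : R) : 0 < t -> 0 <= gamma_integrand m t.
Proof.
  intros Ht; apply Rmult_le_pos; [apply powerRZ_le, Ht|left; apply exp_pos].
Qed.

(** The partial integrals increase, as the integrand is nonnegative, and stay below [C], the
    integral of [C / t ^ 2] from 1 to infinity. *)
Lemma RInt_gamma_integrand_lim (m : Z) :
  exists l, filterlim (fun T => RInt (gamma_integrand m) 1 T)
              (Rbar_locally p_infty) (locally l).
Proof.
  destruct (powerRZ_exp_bound (m - 1)) as [C HC].
  apply increasing_bounded_lim with (a := 1) (M := C * (1 - 0)).
  - intros s t Hs Hst.
    rewrite <- (RInt_Chasles (gamma_integrand m) 1 s t)
      by (apply ex_RInt_gamma_integrand; lra).
    assert (0 <= RInt (gamma_integrand m) s t); [|unfold plus; simpl; lra].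
    apply RInt_ge_0; [exact Hst|apply ex_RInt_gamma_integrand; lra|].
    intros r Hr; apply gamma_integrand_pos; lra.
  - intros t Ht.
    assert (HI := is_RInt_scal _ _ _ C _ (is_RInt_inv_sqr 1 t ltac:(lra) Ht)).
    apply Rle_trans with (C * (/ 1 - / t)).
    + apply (is_RInt_le (gamma_integrand m) (fun s => C * / s ^ 2) 1 t); [exact Ht| |exact HI|].
      * apply (RInt_correct (V := R_CompleteNormedModule)), ex_RInt_gamma_integrand; lra.
      * intros s Hs; apply HC; lra.
    + assert (0 <= C) by (specialize (HC 1 ltac:(lra)); lra).
      assert (0 < / t) by (apply Rinv_0_lt_compat; lra).
      apply Rmult_le_compat_l; lra.
Qed.

Lemma is_RInt_gen_gamma_integrand_1 (m : Z) (l : R) :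
  filterlim (fun T => RInt (gamma_integrand m) 1 T) (Rbar_locally p_infty) (locally l) ->
  is_RInt_gen (gamma_integrand m) (at_point 1) (Rbar_locally p_infty) l.
Proof.
  intros Hl P HP; destruct (Hl P HP) as [M HM].
  apply Filter_prod with (Q := fun a => a = 1) (R := fun b => Rmax M 1 < b).
  - reflexivity.
  - exists (Rmax M 1); auto.
  - intros a b -> Hb; exists (RInt (gamma_integrand m) 1 b); split.
    + apply (RInt_correct (V := R_CompleteNormedModule)), ex_RInt_gamma_integrand; [lra|].
      apply Rlt_trans with (2 := Hb); apply Rlt_le_trans with (2 := Rmax_r _ _); lra.
    + apply HM; apply Rle_lt_trans with (2 := Hb); apply Rmax_l.
Qed.

(** This shows that the total function [upper_gamma] has its intended value: the integral converges
    for every integer order, by reduction to the base point 1. *)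
Lemma is_RInt_gen_upper_gamma (m : Z) (z : R) :
  0 < z ->
  is_RInt_gen (gamma_integrand m) (at_point z) (Rbar_locally p_infty) (upper_gamma m z).
Proof.
  intros Hz.
  apply (RInt_gen_correct (V := R_CompleteNormedModule)).
  apply ex_RInt_gen_Chasles with 1.
  - apply (ex_RInt_gen_at_point (V := R_CompleteNormedModule)), ex_RInt_gamma_integrand; lra.
  - destruct (RInt_gamma_integrand_lim m) as [l Hl].
    exists l; apply is_RInt_gen_gamma_integrand_1, Hl.
Qed.

(** Here [z] becomes the upper bound of a proper integral, from which the derivative and the limit
    at infinity can be read off. *)
Lemma upper_gamma_eq_1 (m : Z) (z : R) :
  0 < z -> upper_gamma m z = upper_gamma m 1 - RInt (gamma_integrand m) 1 z.
Proof.
  intros Hz.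
  assert (H := is_RInt_gen_Chasles _ z _ _
    (proj2 (is_RInt_gen_at_point (gamma_integrand m) 1 z _)
      (RInt_correct (V := R_CompleteNormedModule) _ _ _
         (ex_RInt_gamma_integrand m 1 z Rlt_0_1 Hz)))
    (is_RInt_gen_upper_gamma m z Hz)).
  apply (is_RInt_gen_unique (V := R_CompleteNormedModule)) in H.
  change (upper_gamma m 1 = RInt (gamma_integrand m) 1 z + upper_gamma m z) in H; lra.
Qed.

Lemma is_derive_upper_gamma (m : Z) (z : R) :
  0 < z -> is_derive (upper_gamma m) z (- gamma_integrand m z).
Proof.
  intros Hz.
  apply is_derive_ext_loc with (fun y => upper_gamma m 1 - RInt (gamma_integrand m) 1 y).
  - exists (mkposreal z Hz); intros y Hy; symmetry; apply upper_gamma_eq_1.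
    apply Rabs_def2 in Hy; unfold minus, plus, opp in Hy; simpl in Hy; lra.
  - replace (- gamma_integrand m z) with (minus 0 (gamma_integrand m z))
      by (unfold minus, plus, opp; simpl; ring).
    apply (is_derive_minus (V := R_NormedModule)); [apply (@is_derive_const R_AbsRing)|].
    apply (is_derive_RInt (V := R_NormedModule)) with 1; [|apply gamma_integrand_continuous, Hz].
    exists (mkposreal z Hz); intros y Hy.
    apply (RInt_correct (V := R_CompleteNormedModule)), ex_RInt_gamma_integrand; [lra|].
    apply Rabs_def2 in Hy; unfold minus, plus, opp in Hy; simpl in Hy; lra.
Qed.

Lemma upper_gamma_lim (m : Z) :
  filterlim (upper_gamma m) (Rbar_locally p_infty) (locally 0).
Proof.
  destruct (RInt_gamma_integrand_lim m) as [l Hl].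
  assert (E : upper_gamma m 1 = l).
  { change (RInt_gen (gamma_integrand m) (at_point 1) (Rbar_locally p_infty) = l).
    apply (is_RInt_gen_unique (V := R_CompleteNormedModule)).
    apply is_RInt_gen_gamma_integrand_1, Hl. }
  apply filterlim_ext_loc with (fun y => l + (-1) * RInt (gamma_integrand m) 1 y).
  - exists 0; intros y Hy; rewrite (upper_gamma_eq_1 m y Hy), E; ring.
  - replace 0 with (l + (-1) * l) by ring.
    apply (filterlim_Rplus (Rbar_locally p_infty)); [apply filterlim_const|].
    apply (filterlim_Rmult (Rbar_locally p_infty)); [apply filterlim_const|exact Hl].
Qed.

(** Both sides have the same derivative in [z] and tend to 0 at infinity. Negative [m] is included,
    as the orders [- k] of the theorem require. *)
Lemma upper_gamma_succ (m : Z) (z : R) :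
  0 < z -> upper_gamma (m + 1) z = IZR m * upper_gamma m z + powerRZ z m * exp (- z).
Proof.
  intros Hz.
  set (D := fun y => upper_gamma (m + 1) y
              + ((- IZR m) * upper_gamma m y + (-1) * (powerRZ y m * exp (- y)))).
  assert (HD : forall y, 0 < y -> is_derive D y 0).
  { intros y Hy.
    assert (HP := is_derive_powerRZ m y Hy).
    assert (HE : is_derive (fun t => exp (- t)) y (- exp (- y))).
    { auto_derive; [exact I|ring]. }
    assert (HM := is_derive_mult _ _ _ _ _ HP HE Rmult_comm).
    assert (H := is_derive_plus _ _ _ _ _ (is_derive_upper_gamma (m + 1) y Hy)
      (is_derive_plus _ _ _ _ _
         (is_derive_scal _ _ (- IZR m) _ (is_derive_upper_gamma m y Hy))
         (is_derive_scal _ _ (-1) _ HM))).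
    evar_last; [exact H|].
    unfold gamma_integrand, plus, mult; simpl.
    replace (m + 1 - 1)%Z with m by lia; ring. }
  assert (HL : filterlim D (Rbar_locally p_infty) (locally 0)).
  { replace 0 with (0 + ((- IZR m) * 0 + (-1) * 0)) by ring.
    apply (filterlim_Rplus (Rbar_locally p_infty)); [apply upper_gamma_lim|].
    apply (filterlim_Rplus (Rbar_locally p_infty));
      apply (filterlim_Rmult (Rbar_locally p_infty)); try apply filterlim_const.
    - apply upper_gamma_lim.
    - apply powerRZ_exp_lim. }
  assert (H0 : D z = 0).
  { apply (filterlim_locally_unique (F := Rbar_locally p_infty) (V := R_NormedModule) D);
      [|exact HL].
    apply filterlim_ext_loc with (fun _ => D z); [|apply filterlim_const].
    exists 0; intros y Hy; apply zero_derive_pos; assumption. }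
  unfold D in H0; lra.
Qed.

Lemma filterlim_at_right_continuous (f : R -> R) (a : R) :
  continuous f a -> filterlim f (at_right a) (locally (f a)).
Proof.
  intros H P HP; apply filter_le_within, H, HP.
Qed.

Lemma filterlim_affine_p_infty (x c : R) :
  0 < x -> filterlim (fun t => x * (c + t)) (Rbar_locally p_infty) (Rbar_locally p_infty).
Proof.
  intros Hx P [M HM]; exists (M / x - c); intros t Ht; apply HM.
  apply Rmult_lt_reg_r with (/ x); [apply Rinv_0_lt_compat, Hx|].
  replace (x * (c + t) * / x) with (c + t) by (field; lra).
  unfold Rdiv in Ht; lra.
Qed.

(** The substitution [s = x * (1 + t)], carried out through the explicit antiderivative [F]. *)
Lemma is_RInt_gen_upper_gamma_shift (m : Z) (x : R) :
  0 < x ->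
  is_RInt_gen (fun t => powerRZ (1 + t) (m - 1) * exp (- (x * t)))
    (at_right 0) (Rbar_locally p_infty) (exp x * powerRZ x (- m) * upper_gamma m x).
Proof.
  intros Hx.
  set (K := exp x * powerRZ x (- m)).
  set (F := fun t => - K * upper_gamma m (x * (1 + t))).
  replace (K * upper_gamma m x) with (0 - F 0)
    by (unfold F; replace (x * (1 + 0)) with x by ring; ring).
  (* The range contains 0, which gives the continuity of [F] at the left endpoint. *)
  assert (HD : forall t, -1 < t ->
    is_derive F t (powerRZ (1 + t) (m - 1) * exp (- (x * t)))).
  { intros t Ht.
    assert (Hp : 0 < x * (1 + t)) by (apply Rmult_lt_0_compat; lra).
    assert (HA : is_derive (fun t => x * (1 + t)) t x) by (auto_derive; [exact I|ring]).
    assert (H := is_derive_scal _ _ (- K) _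
      (is_derive_comp _ _ _ _ _ (is_derive_upper_gamma m _ Hp) HA)).
    evar_last; [exact H|].
    unfold gamma_integrand, K, scal; simpl; unfold mult; simpl.
    rewrite powerRZ_mult.
    replace (- (x * (1 + t))) with (- x + - (x * t)) by ring.
    rewrite exp_plus, exp_Ropp.
    assert (HX : powerRZ x (- m) * powerRZ x (m - 1) * x = 1).
    { rewrite <- powerRZ_add by lra.
      replace (- m + (m - 1))%Z with (-1)%Z by lia; simpl; field; lra. }
    assert (He := exp_pos x).
    transitivity (powerRZ x (- m) * powerRZ x (m - 1) * x * (exp x * / exp x)
                  * powerRZ (1 + t) (m - 1) * exp (- (x * t))); [ring|].
    rewrite HX, Rinv_r by lra; ring. }
  apply is_RInt_gen_antiderivative with F.
  - intros t Ht; apply HD; lra.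
  - intros t Ht.
    apply (continuous_mult (fun t => powerRZ (1 + t) (m - 1)) (fun t => exp (- (x * t)))).
    + apply (continuous_comp (fun t => 1 + t) (fun s => powerRZ s (m - 1))).
      * apply (ex_derive_continuous (V := R_NormedModule)); auto_derive; exact I.
      * eapply is_derive_continuous, is_derive_powerRZ; lra.
    + apply (ex_derive_continuous (V := R_NormedModule)); auto_derive; exact I.
  - apply filterlim_at_right_continuous; eapply is_derive_continuous, HD; lra.
  - replace 0 with (- K * 0) by ring.
    apply (filterlim_Rmult (Rbar_locally p_infty)); [apply filterlim_const|].
    eapply filterlim_comp; [apply filterlim_affine_p_infty, Hx|apply upper_gamma_lim].
Qed.

(** * The complementary exponential integral *)

(* [(1 - exp (- t)) / t] with its removable singularity filled in. *)
Definition Ein_integrand (t : R) : R :=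
  if Req_EM_T t 0 then 1 else (1 - exp (- t)) / t.

Lemma Ein_integrand_continuous (t : R) : continuous Ein_integrand t.
Proof.
  destruct (Req_dec t 0) as [->|Ht].
  (* This limit is used at [- y] below. *)
  - assert (HL : is_lim (fun y => (exp y - 1) / y) 0 1) by apply is_lim_div_expm1_0.
    apply filterlim_locally; intros eps.
    unfold Ein_integrand at 1; destruct (Req_EM_T 0 0) as [_|]; [|lra].
    assert (H := proj1 (filterlim_locally _ _) HL eps).
    destruct H as [d Hd]; exists d; intros y Hy.
    unfold Ein_integrand; destruct (Req_EM_T y 0) as [->|Hy0]; [apply ball_center|].
    replace ((1 - exp (- y)) / y) with ((exp (- y) - 1) / (- y)) by (field; exact Hy0).
    apply Hd; [|lra].
    unfold ball in *; simpl in *; unfold AbsRing_ball, abs, minus, plus, opp in *; simpl in *.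
    replace (- y + - 0) with (- (y + - 0)) by ring; rewrite Rabs_Ropp; exact Hy.
  - apply continuous_ext_loc with (fun y => (1 - exp (- y)) / y).
    + exists (mkposreal _ (Rabs_pos_lt t Ht)); intros y Hy.
      unfold Ein_integrand; destruct (Req_EM_T y 0) as [->|Hy0]; [exfalso|reflexivity].
      unfold ball in Hy; simpl in Hy; unfold AbsRing_ball, abs, minus, plus, opp in Hy; simpl in Hy.
      replace (0 + - t) with (- t) in Hy by ring; rewrite Rabs_Ropp in Hy; lra.
    + apply (ex_derive_continuous (V := R_NormedModule)); auto_derive; exact Ht.
Qed.

Lemma Ein_RInt (z : R) : Ein z = RInt Ein_integrand 0 z.
Proof.
  unfold Ein; apply RInt_ext; intros t Ht.
  unfold Ein_integrand; destruct (Req_EM_T t 0) as [->|]; [exfalso|reflexivity].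
  revert Ht; unfold Rmin, Rmax; destruct (Rle_dec 0 z); lra.
Qed.

(** The point 0 is included because the singularity is filled in; the antiderivative for [A 0] below
    is differentiated there. *)
Lemma is_derive_Ein (z : R) : is_derive Ein z (Ein_integrand z).
Proof.
  apply (is_derive_ext (fun z => RInt Ein_integrand 0 z));
    [intros y; symmetry; apply Ein_RInt|].
  apply (is_derive_RInt (V := R_NormedModule)) with 0; [|apply Ein_integrand_continuous].
  apply filter_forall; intros y.
  apply (RInt_correct (V := R_CompleteNormedModule)).
  apply (ex_RInt_continuous (V := R_CompleteNormedModule)).
  intros; apply Ein_integrand_continuous.
Qed.

Lemma Ein_0 : Ein 0 = 0.
Proof. unfold Ein; rewrite RInt_point; reflexivity. Qed.

(* [Ein - ln - Gamma(0, .)] is constant (equal to Euler's constant). *)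
Lemma Ein_upper_gamma_0 (x y : R) :
  0 < x -> 0 < y ->
  Ein y - ln y - upper_gamma 0 y = Ein x - ln x - upper_gamma 0 x.
Proof.
  intros Hx Hy.
  assert (HD : forall t, 0 < t ->
    is_derive (fun t => Ein t - ln t - upper_gamma 0 t) t 0).
  { intros t Ht.
    assert (HL : is_derive ln t (/ t)) by (auto_derive; [exact Ht|field; lra]).
    evar_last.
    - exact (is_derive_minus _ _ _ _ _ (is_derive_minus _ _ _ _ _ (is_derive_Ein t) HL)
               (is_derive_upper_gamma 0 t Ht)).
    - unfold Ein_integrand, gamma_integrand, minus, plus, opp; simpl.
      destruct (Req_EM_T t 0); [lra|field; exact n]. }
  exact (zero_derive_pos _ HD y x Hy Hx).
Qed.

(** * Integration by parts *)

(** The upper bound is [1 + u <= exp u] at [u = / t]. *)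
Lemma ln_succ_ratio_bounds (t : R) : 0 < t -> 0 <= ln ((1 + t) / t) <= 1 / t.
Proof.
  intros Ht; assert (Hi : 0 < / t) by (apply Rinv_0_lt_compat, Ht).
  replace ((1 + t) / t) with (1 + 1 / t) by (field; lra).
  unfold Rdiv; rewrite Rmult_1_l; split.
  - rewrite <- ln_1; apply Rcomplements.ln_le; lra.
  - rewrite <- (ln_exp (/ t)) at 2; apply Rcomplements.ln_le; [lra|].
    left; apply exp_ineq1; lra.
Qed.

Lemma ln_succ_ratio_lim :
  filterlim (fun t => ln ((1 + t) / t)) (Rbar_locally p_infty) (locally 0).
Proof.
  apply (filterlim_squeeze_0 (Rbar_locally p_infty)) with (fun t => 1 / t);
    [|apply filterlim_div_p_infty].
  exists 0; intros t Ht; destruct (ln_succ_ratio_bounds t Ht).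
  rewrite Rabs_pos_eq; assumption.
Qed.

(* From [ln y <= 2 * sqrt y]. *)
Lemma mul_ln_succ_ratio_lim_0 :
  filterlim (fun t => t * ln ((1 + t) / t)) (at_right 0) (locally 0).
Proof.
  apply (filterlim_squeeze_0 (at_right 0)) with (fun t => 2 * sqrt (t * (1 + t))).
  - exists (mkposreal 1 Rlt_0_1); intros t _ Ht.
    destruct (ln_succ_ratio_bounds t Ht) as [H0 _].
    assert (Hr : 0 < (1 + t) / t) by (apply Rdiv_lt_0_compat; lra).
    assert (Hs := sqrt_lt_R0 _ Hr).
    rewrite Rabs_pos_eq by (apply Rmult_le_pos; lra).
    rewrite <- (sqrt_sqrt ((1 + t) / t)) at 1 by lra.
    rewrite ln_mult by assumption.
    replace (sqrt (t * (1 + t))) with (t * sqrt ((1 + t) / t)).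
    + assert (ln (sqrt ((1 + t) / t)) <= sqrt ((1 + t) / t)); [|nra].
      rewrite <- (ln_exp (sqrt _)) at 2; apply Rcomplements.ln_le; [exact Hs|].
      left; apply Rlt_trans with (2 := exp_ineq1 _ (Rgt_not_eq _ _ Hs)); lra.
    + rewrite <- (sqrt_Rsqr t) at 1 by lra.
      rewrite <- sqrt_mult by (try apply Rle_0_sqr; lra).
      f_equal; unfold Rsqr; field; lra.
  - replace (locally 0) with (locally (2 * sqrt (0 * (1 + 0))))
      by (f_equal; rewrite Rmult_0_l, sqrt_0; ring).
    apply (filterlim_at_right_continuous (fun t => 2 * sqrt (t * (1 + t))) 0).
    apply (continuous_scal_r 2 (fun t => sqrt (t * (1 + t)))).
    apply (continuous_comp (fun t => t * (1 + t)) sqrt); [|apply continuous_sqrt].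
    apply (ex_derive_continuous (V := R_NormedModule)); auto_derive; exact I.
Qed.

(** The integrand of [A n]. The factor [1 / (t (1 + t))] is minus the derivative of
    [ln ((1 + t) / t)]. *)
Definition one_sub_exp_quot (x : R) (n : nat) (t : R) : R :=
  (1 - (1 + t) ^ n * exp (- (x * t))) / (t * (1 + t)).

Lemma one_sub_exp_quot_continuous (x : R) (n : nat) (t : R) :
  0 < t -> continuous (one_sub_exp_quot x n) t.
Proof.
  intros Ht; apply (ex_derive_continuous (V := R_NormedModule)).
  unfold one_sub_exp_quot; auto_derive.
  apply Rgt_not_eq, Rmult_lt_0_compat; lra.
Qed.

(** Since [1 / (t (1 + t)) = 1 / t - 1 / (1 + t)], an antiderivative is [Ein (x t) - ln (1 + t) -
    e^x Gamma(0, x (1 + t))]. *)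
Lemma is_RInt_gen_one_sub_exp_quot_0 (x : R) :
  0 < x ->
  is_RInt_gen (one_sub_exp_quot x 0) (at_right 0) (Rbar_locally p_infty)
    (Ein x + (exp x - 1) * upper_gamma 0 x).
Proof.
  intros Hx.
  set (F := fun t => Ein (x * t) - ln (1 + t) + - exp x * upper_gamma 0 (x * (1 + t))).
  assert (F0 : F 0 = - exp x * upper_gamma 0 x).
  { unfold F; replace (x * (1 + 0)) with x by ring.
    rewrite Rmult_0_r, Rplus_0_r, ln_1, Ein_0; ring. }
  replace (Ein x + (exp x - 1) * upper_gamma 0 x)
    with (Ein x - upper_gamma 0 x - F 0) by (rewrite F0; ring).
  assert (HD : forall t, -1 < t -> is_derive F t
    (x * Ein_integrand (x * t) - / (1 + t)
     + exp x * (x * gamma_integrand 0 (x * (1 + t))))).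
  { intros t Ht.
    assert (Hp : 0 < x * (1 + t)) by (apply Rmult_lt_0_compat; lra).
    assert (HA : is_derive (fun t => x * (1 + t)) t x) by (auto_derive; [exact I|ring]).
    assert (HB : is_derive (fun t => x * t) t x) by (auto_derive; [exact I|ring]).
    assert (HL : is_derive (fun t => ln (1 + t)) t (/ (1 + t)))
      by (auto_derive; [lra|field; lra]).
    evar_last.
    - exact (is_derive_plus _ _ _ _ _
        (is_derive_minus _ _ _ _ _
           (is_derive_comp _ _ _ _ _ (is_derive_Ein (x * t)) HB) HL)
        (is_derive_scal _ _ (- exp x) _
           (is_derive_comp _ _ _ _ _ (is_derive_upper_gamma 0 _ Hp) HA))).
    - unfold scal, minus, plus, opp; simpl; unfold mult; simpl; ring. }
  apply is_RInt_gen_antiderivative with F.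
  - intros t Ht; evar_last; [apply HD; lra|].
    assert (0 < x * t) by (apply Rmult_lt_0_compat; lra).
    unfold Ein_integrand, gamma_integrand, one_sub_exp_quot; simpl.
    destruct (Req_EM_T (x * t) 0); [lra|].
    replace (- (x * (1 + t))) with (- x + - (x * t)) by ring.
    rewrite exp_plus, (exp_Ropp x); assert (He := exp_pos x).
    field; repeat split; lra.
  - intros t Ht; apply one_sub_exp_quot_continuous, Ht.
  - apply filterlim_at_right_continuous; eapply is_derive_continuous, HD; lra.
  (* [Ein (x t)] and [ln (1 + t)] both diverge. Replacing the former by [Ein x - Gamma(0, x) + ln t
     + Gamma(0, x t)] leaves convergent terms only. The shape [0 + t] lets [HG] serve both gamma
     terms. *)
  - apply filterlim_ext_loc with (fun t =>
      (Ein x - upper_gamma 0 x) +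
      (-1 * ln ((1 + t) / t) +
       (upper_gamma 0 (x * (0 + t)) + - exp x * upper_gamma 0 (x * (1 + t))))).
    + exists 0; intros t Ht; unfold F.
      assert (Hp : 0 < x * t) by (apply Rmult_lt_0_compat; lra).
      assert (H := Ein_upper_gamma_0 x (x * t) Hx Hp).
      rewrite ln_mult in H by lra; rewrite Rcomplements.ln_div, Rplus_0_l by lra; lra.
    + replace (locally (Ein x - upper_gamma 0 x)) with
        (locally (Ein x - upper_gamma 0 x + (-1 * 0 + (0 + - exp x * 0))))
        by (f_equal; ring).
      assert (HG : forall c, filterlim (fun t => upper_gamma 0 (x * (c + t)))
                     (Rbar_locally p_infty) (locally 0)).
      { intros c; eapply filterlim_comp;
          [apply filterlim_affine_p_infty, Hx|apply upper_gamma_lim]. }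
      apply (filterlim_Rplus (Rbar_locally p_infty)); [apply filterlim_const|].
      apply (filterlim_Rplus (Rbar_locally p_infty)).
      * apply (filterlim_Rmult (Rbar_locally p_infty)); [apply filterlim_const|].
        apply ln_succ_ratio_lim.
      * apply (filterlim_Rplus (Rbar_locally p_infty)); [apply HG|].
        apply (filterlim_Rmult (Rbar_locally p_infty)); [apply filterlim_const|apply HG].
Qed.

(** The two numerators differ by [t (1 + t)^n exp (- x t)], and division by [t (1 + t)] leaves the
    integrand of the shifted gamma integral. At [n = 0] its exponent is -1, hence the integer
    power. *)
Lemma is_RInt_gen_one_sub_exp_quot_succ (x : R) (n : nat) (a : R) :
  0 < x ->
  is_RInt_gen (one_sub_exp_quot x n) (at_right 0) (Rbar_locally p_infty) a ->
  is_RInt_gen (one_sub_exp_quot x (S n)) (at_right 0) (Rbar_locally p_infty)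
    (a - exp x * powerRZ x (- Z.of_nat n) * upper_gamma (Z.of_nat n) x).
Proof.
  intros Hx Ha.
  eapply is_RInt_gen_ext_pos;
    [|exact (is_RInt_gen_minus _ _ _ _ Ha (is_RInt_gen_upper_gamma_shift (Z.of_nat n) x Hx))].
  intros t Ht; unfold one_sub_exp_quot, minus, plus, opp; simpl.
  unfold Z.sub; rewrite powerRZ_add, <- pow_powerRZ by lra; simpl; field; lra.
Qed.

(** The integrand of [J n]. It agrees for [t > 0] with that of [I1star] at the parameters of the
    theorem, where the exponents of [t] and [1 + t] are 0 and [n]. *)
Definition log_integrand (x : R) (n : nat) (t : R) : R :=
  exp (- (x * t)) * (1 + t) ^ n * ln ((1 + t) / t).

(** The combination is the derivative of [phi t * ln ((1 + t) / t)], which tends to 0 at both ends.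
    Integrating it as a whole presupposes no convergence of the separate terms. *)
Lemma log_integrand_by_parts (x : R) (n : nat) :
  0 < x ->
  is_RInt_gen (fun t => x * log_integrand x n t - INR n * log_integrand x (pred n) t
                        - one_sub_exp_quot x n t)
    (at_right 0) (Rbar_locally p_infty) 0.
Proof.
  intros Hx.
  (* The constant 1 makes [phi] vanish at 0, where the logarithm blows up. *)
  set (phi := fun t => 1 - (1 + t) ^ n * exp (- (x * t))).
  replace 0 with (0 - 0) at 2 by ring.
  assert (Hr : forall t, 0 < t -> 0 < (1 + t) / t)
    by (intros t Ht; apply Rdiv_lt_0_compat; lra).
  apply is_RInt_gen_antiderivative with (fun t => phi t * ln ((1 + t) / t)).
  - intros t Ht; unfold phi, log_integrand, one_sub_exp_quot; auto_derive.
    + repeat split; [lra|]; exact (Hr t Ht).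
    + unfold Rdiv.
      generalize (ln ((1 + t) * / t)), (exp (- (x * t))), ((1 + t) ^ n),
        ((1 + t) ^ pred n).
      intros; field; lra.
  - intros t Ht; apply (ex_derive_continuous (V := R_NormedModule)).
    unfold log_integrand, one_sub_exp_quot; auto_derive.
    assert (H := Hr t Ht); repeat split; try lra; try exact H.
    apply Rgt_not_eq, Rmult_lt_0_compat; lra.
  (* [l] is the derivative of [phi] at 0, hence the limit of [phi t / t]; the other factor
     [t * ln ((1 + t) / t)] tends to 0. *)
  - set (l := x - INR n).
    apply filterlim_ext_loc with (fun t => (phi t / t) * (t * ln ((1 + t) / t))).
    { exists (mkposreal 1 Rlt_0_1); intros t _ Ht; field; lra. }
    replace (locally 0) with (locally (l * 0)) by (f_equal; ring).
    apply (filterlim_Rmult (at_right 0)); [|apply mul_ln_succ_ratio_lim_0].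
    assert (Hphi : is_derive phi 0 l).
    { unfold phi; auto_derive; [exact I|].
      rewrite Rmult_0_r, Ropp_0, exp_0, Rplus_0_r, !pow1; unfold l; ring. }
    apply is_derive_Reals in Hphi.
    apply filterlim_locally; intros [e He].
    destruct (Hphi e He) as [d Hd]; exists d; intros t Ht Ht0.
    specialize (Hd t (Rgt_not_eq _ _ Ht0)).
    unfold ball in *; simpl in *; unfold AbsRing_ball, abs, minus, plus, opp in *; simpl in *.
    replace (t + - 0) with t in Ht by ring.
    replace (phi t / t + - l) with ((phi (0 + t) - phi 0) / t - l); [exact (Hd Ht)|].
    rewrite Rplus_0_l; replace (phi 0) with 0; [field; lra|].
    unfold phi; rewrite Rmult_0_r, Ropp_0, exp_0, Rplus_0_r, pow1; ring.
  (* At infinity [phi] tends to 1 and the logarithm to 0. Rewriting [phi] in terms of [x * (1 + t)]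
     brings in the decay of [y ^ n * exp (- y)]. *)
  - replace (locally 0)
      with (locally ((1 + - (exp x * powerRZ x (- Z.of_nat n)) * 0) * 0))
      by (f_equal; ring).
    apply (filterlim_Rmult (Rbar_locally p_infty)); [|apply ln_succ_ratio_lim].
    apply filterlim_ext_loc with (fun t =>
      1 + - (exp x * powerRZ x (- Z.of_nat n))
            * (powerRZ (x * (1 + t)) (Z.of_nat n) * exp (- (x * (1 + t))))).
    + exists 0; intros t Ht; unfold phi.
      rewrite powerRZ_neg', <- !pow_powerRZ, Rpow_mult_distr.
      replace (- (x * (1 + t))) with (- x + - (x * t)) by ring.
      rewrite exp_plus, (exp_Ropp x).
      assert (He := exp_pos x); assert (x ^ n <> 0) by (apply pow_nonzero; lra).
      field; split; [lra|assumption].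
    + apply (filterlim_Rplus (Rbar_locally p_infty)); [apply filterlim_const|].
      apply (filterlim_Rmult (Rbar_locally p_infty)); [apply filterlim_const|].
      eapply (filterlim_comp _ _ _ (fun t => x * (1 + t))
                (fun y => powerRZ y (Z.of_nat n) * exp (- y)));
        [apply filterlim_affine_p_infty, Hx|apply powerRZ_exp_lim].
Qed.

(** The first integral carries the factor [INR n], so at [n = 0] it is that of the zero function and
    the induction on [n] can start. *)
Lemma is_RInt_gen_log_integrand_step (x : R) (n : nat) (j a : R) :
  0 < x ->
  is_RInt_gen (fun t => INR n * log_integrand x (pred n) t)
    (at_right 0) (Rbar_locally p_infty) j ->
  is_RInt_gen (one_sub_exp_quot x n) (at_right 0) (Rbar_locally p_infty) a ->
  is_RInt_gen (log_integrand x n) (at_right 0) (Rbar_locally p_infty) ((j + a) / x).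
Proof.
  intros Hx Hj Ha.
  assert (H := is_RInt_gen_scal _ (/ x) _
    (is_RInt_gen_plus _ _ _ _ (log_integrand_by_parts x n Hx)
       (is_RInt_gen_plus _ _ _ _ Hj Ha))).
  replace ((j + a) / x) with (scal (/ x) (plus 0 (plus j a)))
    by (unfold scal, plus; simpl; unfold mult; simpl; field; lra).
  eapply is_RInt_gen_ext_pos; [|exact H].
  intros t Ht; unfold scal, plus; simpl; unfold mult; simpl; field; lra.
Qed.

(** * The lower incomplete gamma function *)

(** A natural exponent makes the integrand continuous on the whole line, which gives access to
    negative [z]. *)
Lemma lower_gamma_nat (k : nat) (z : R) :
  lower_gamma (Z.of_nat k + 1) z = RInt (fun t => t ^ k * exp (- t)) 0 z.
Proof.
  unfold lower_gamma; apply RInt_ext; intros t _.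
  rewrite pow_powerRZ; do 2 f_equal; lia.
Qed.

Lemma lower_gamma_0 (k : nat) : lower_gamma (Z.of_nat k + 1) 0 = 0.
Proof. unfold lower_gamma; rewrite RInt_point; reflexivity. Qed.

Lemma is_derive_lower_gamma (k : nat) (z : R) :
  is_derive (lower_gamma (Z.of_nat k + 1)) z (z ^ k * exp (- z)).
Proof.
  assert (HC : forall t, continuous (fun t => t ^ k * exp (- t)) t).
  { intros t; apply (ex_derive_continuous (V := R_NormedModule)); auto_derive; exact I. }
  apply (is_derive_ext (fun z => RInt (fun t => t ^ k * exp (- t)) 0 z));
    [intros y; symmetry; apply lower_gamma_nat|].
  apply (is_derive_RInt (V := R_NormedModule) (fun t => t ^ k * exp (- t))) with 0;
    [|apply HC].
  apply filter_forall; intros y.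
  apply (RInt_correct (V := R_CompleteNormedModule)).
  apply (ex_RInt_continuous (V := R_CompleteNormedModule)).
  intros; apply HC.
Qed.

Lemma lower_gamma_1 (z : R) : lower_gamma (Z.of_nat 0 + 1) z = 1 - exp (- z).
Proof.
  set (D := fun y => lower_gamma (Z.of_nat 0 + 1) y - (1 - exp (- y))).
  assert (HD : forall y, is_derive D y 0).
  { intros y.
    assert (HE : is_derive (fun t => 1 - exp (- t)) y (exp (- y)))
      by (auto_derive; [exact I|ring]).
    evar_last; [exact (is_derive_minus _ _ _ _ _ (is_derive_lower_gamma 0 y) HE)|].
    unfold minus, plus, opp; simpl; ring. }
  assert (H := zero_derive_eq D HD z 0); unfold D in H.
  rewrite lower_gamma_0, Ropp_0, exp_0 in H; lra.
Qed.

(** Both sides have the same derivative and vanish at 0. *)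
Lemma lower_gamma_succ (k : nat) (z : R) :
  lower_gamma (Z.of_nat (S k) + 1) z =
  INR (S k) * lower_gamma (Z.of_nat k + 1) z - z ^ (S k) * exp (- z).
Proof.
  set (D := fun y => lower_gamma (Z.of_nat (S k) + 1) y
     - (INR (S k) * lower_gamma (Z.of_nat k + 1) y - y ^ (S k) * exp (- y))).
  assert (HD : forall y, is_derive D y 0).
  { intros y.
    assert (HE : is_derive (fun t => t ^ (S k) * exp (- t)) y
        (INR (S k) * y ^ k * exp (- y) - y ^ (S k) * exp (- y)))
      by (auto_derive; [exact I|change (match k with 0%nat => 1 | S _ => INR k + 1 end)
                                  with (INR (S k)); generalize (INR (S k)); intros; simpl; ring]).
    evar_last.
    - exact (is_derive_minus _ _ _ _ _ (is_derive_lower_gamma (S k) y)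
        (is_derive_minus _ _ _ _ _
          (is_derive_scal _ _ (INR (S k)) _ (is_derive_lower_gamma k y)) HE)).
    - generalize (INR (S k)); intros; unfold minus, plus, opp; simpl; ring. }
  assert (H := zero_derive_eq D HD z 0); unfold D in H.
  rewrite !lower_gamma_0, pow_i in H by lia; lra.
Qed.

(* Expand [(y - x) ^ m] under the integral after the substitution [t = y - x]. *)
Lemma lower_gamma_opp (m : nat) (x : R) :
  lower_gamma (Z.of_nat m + 1) (- x) =
  - exp x * sum_n (fun l => Binomial.C m l * (- x) ^ (m - l)
                            * lower_gamma (Z.of_nat l + 1) x) m.
Proof.
  set (D := fun y =>
    sum_n (fun l => Binomial.C m l * (- x) ^ (m - l) * lower_gamma (Z.of_nat l + 1) y) m
    - exp (- x) * lower_gamma (Z.of_nat m + 1) (y - x)).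
  assert (HD : forall y, is_derive D y 0).
  { intros y.
    assert (HS : is_derive (fun y => y - x) y 1) by (auto_derive; [exact I|ring]).
    assert (HM : is_derive
      (fun y => sum_n (fun l => Binomial.C m l * (- x) ^ (m - l)
                                * lower_gamma (Z.of_nat l + 1) y) m) y
      (sum_n (fun l => Binomial.C m l * (- x) ^ (m - l) * (y ^ l * exp (- y))) m)).
    { apply (is_derive_sum_n (V := R_NormedModule)
        (fun l y => Binomial.C m l * (- x) ^ (m - l) * lower_gamma (Z.of_nat l + 1) y)).
      intros l _; exact (is_derive_scal _ _ (Binomial.C m l * (- x) ^ (m - l)) _
                           (is_derive_lower_gamma l y)). }
    evar_last.
    - exact (is_derive_minus _ _ _ _ _ HM
        (is_derive_scal _ _ (exp (- x)) _
           (is_derive_comp (lower_gamma (Z.of_nat m + 1)) (fun y => y - x) _ _ _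
              (is_derive_lower_gamma m (y - x)) HS))).
    - replace (sum_n (fun l => Binomial.C m l * (- x) ^ (m - l) * (y ^ l * exp (- y))) m)
        with ((y - x) ^ m * exp (- y)).
      + unfold minus, plus, opp, scal; simpl; unfold mult; simpl.
        replace (- y) with (- x + - (y - x)) at 1 by ring; rewrite exp_plus; ring.
      + unfold Rminus; rewrite binomial, sum_n_Reals, Rmult_comm, scal_sum.
        apply sum_eq; intros l _; ring. }
  (* At [y = x] the second term of [D] vanishes, and at [y = 0] the sum does. *)
  assert (H := zero_derive_eq D HD x 0); unfold D in H.
  replace (x - x) with 0 in H by ring; replace (0 - x) with (- x) in H by ring.
  rewrite lower_gamma_0 in H.
  rewrite (sum_n_ext (fun l => Binomial.C m l * (- x) ^ (m - l)
             * lower_gamma (Z.of_nat l + 1) 0) (fun _ => 0)) in H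
    by (intros l; rewrite lower_gamma_0; apply Rmult_0_r).
  rewrite sum_n_const, Rmult_0_r in H.
  assert (He : exp x * exp (- x) = 1) by (rewrite <- exp_plus, Rplus_opp_r; apply exp_0).
  apply Rmult_eq_reg_l with (exp (- x)); [|apply Rgt_not_eq, exp_pos].
  transitivity (- (exp x * exp (- x))
     * sum_n (fun l => Binomial.C m l * (- x) ^ (m - l) * lower_gamma (Z.of_nat l + 1) x) m);
    [rewrite He; lra|ring].
Qed.

Lemma sum_pascal (w : nat -> R) (k : nat) :
  sum_n_m (fun l => Binomial.C (S k) l * w l) 1 (S k) =
  sum_n_m (fun l => Binomial.C k l * w l) 1 k + sum_n (fun l => Binomial.C k l * w (S l)) k.
Proof.
  rewrite <- sum_n_m_S; fold (sum_n (fun l => Binomial.C (S k) (S l) * w (S l)) k).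
  destruct k as [|k].
  - rewrite sum_n_m_zero by lia; rewrite !sum_O, C_n_0, C_n_n; unfold zero; simpl; ring.
  - rewrite <- (sum_n_m_S _ 0 k); fold (sum_n (fun l => Binomial.C (S k) (S l) * w (S l)) k).
    (* The top term is split off before Pascal's rule: truncated subtraction keeps [Binomial.C n p]
       from vanishing at [p = n + 1]. *)
    rewrite !sum_Sn, !C_n_n.
    rewrite (sum_n_ext_loc _ (fun l => plus (Binomial.C (S k) (S l) * w (S l))
                                            (Binomial.C (S k) l * w (S l)))).
    + rewrite sum_n_plus; unfold plus; simpl; ring.
    + intros l Hl; rewrite <- pascal by lia; unfold plus; simpl; ring.
Qed.

(** * The recurrence of the expression in braces *)

Definition brace (x : R) (k : nat) : R :=
  (-1) ^ (k + 1) * upper_gamma (- Z.of_nat k) x * lower_gamma (Z.of_nat k + 1) (- x)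
  - harmonic k
  - sum_n_m (fun l : nat => Binomial.C k l * powerRZ (- x) (- Z.of_nat l)
                            * lower_gamma (Z.of_nat l) x) 1 k.

(** Hence [Ein x + brace x 0] is [A 0]. *)
Lemma brace_0 (x : R) : brace x 0 = (exp x - 1) * upper_gamma 0 x.
Proof.
  unfold brace, harmonic; rewrite !sum_n_m_zero by lia.
  rewrite lower_gamma_1, Ropp_involutive; unfold zero; simpl; ring.
Qed.

(** [upper_gamma_succ] at order [- (k + 1)], arranged as the sum that [fact_conv_succ_mul]
    produces. *)
Lemma upper_gamma_neg_succ (x : R) (k : nat) :
  0 < x ->
  INR (S k) * upper_gamma (- Z.of_nat (S k)) x + upper_gamma (- Z.of_nat k) x =
  exp (- x) * (/ x) ^ S k.
Proof.
  intros Hx; assert (H := upper_gamma_succ (- Z.of_nat (S k)) x Hx).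
  rewrite opp_IZR, <- INR_IZR_INZ, powerRZ_neg', <- pow_powerRZ, <- pow_inv in H.
  replace (- Z.of_nat (S k) + 1)%Z with (- Z.of_nat k)%Z in H by lia; lra.
Qed.

(** The growth of the binomial sum is a multiple of [lam] and cancels against the [lam] terms of the
    gamma products. What remains, [x^(k+1) e^x Gamma(-k-1, x) - 1 / (k + 1)], is a multiple of
    [Gamma(-k, x)] by [upper_gamma_neg_succ]. *)
Lemma brace_succ (x : R) (k : nat) :
  0 < x ->
  (/ x) ^ S k * (brace x (S k) - brace x k) =
  - exp x * (upper_gamma (- Z.of_nat k) x / INR (S k)).
Proof.
  intros Hx.
  set (lam := lower_gamma (Z.of_nat k + 1) (- x)).
  assert (Hx0 : x ^ S k <> 0) by (apply pow_nonzero; lra).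
  assert (He := exp_pos x).
  (* The extra sum from Pascal's rule is, up to the factor [(- / x) ^ S k], the expansion of [lam]
     given by [lower_gamma_opp]. *)
  assert (HS : sum_n (fun l => Binomial.C k l * (powerRZ (- x) (- Z.of_nat (S l))
                               * lower_gamma (Z.of_nat (S l)) x)) k
               = (-1) ^ k * (/ x) ^ S k * exp (- x) * lam).
  { unfold lam; rewrite lower_gamma_opp.
    transitivity ((- / x) ^ S k * sum_n (fun l => Binomial.C k l * (- x) ^ (k - l)
                              * lower_gamma (Z.of_nat l + 1) x) k).
    - rewrite !sum_n_Reals, scal_sum; apply sum_eq; intros l Hl.
      rewrite powerRZ_neg', <- pow_powerRZ, <- pow_inv.
      replace (Z.of_nat (S l)) with (Z.of_nat l + 1)%Z by lia.
      replace (S k) with (S l + (k - l))%nat at 1 by lia; rewrite pow_add.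
      rewrite <- Rinv_opp.
      assert (HP : (/ - x) ^ (k - l) * (- x) ^ (k - l) = 1).
      { rewrite <- Rpow_mult_distr, Rinv_l by lra; apply pow1. }
      transitivity ((/ - x) ^ S l * ((/ - x) ^ (k - l) * (- x) ^ (k - l))
        * Binomial.C k l * lower_gamma (Z.of_nat l + 1) x); [rewrite HP|simpl]; ring.
    - replace (- / x) with ((-1) * / x) by ring; rewrite Rpow_mult_distr, exp_Ropp.
      simpl; field; lra. }
  assert (Hg := upper_gamma_neg_succ x k Hx).
  assert (Hh : harmonic (S k) = harmonic k + / INR (S k))
    by (unfold harmonic; rewrite sum_n_Sm by lia; reflexivity).
  unfold brace; rewrite Hh.
  rewrite (sum_n_m_ext_loc _ (fun l => Binomial.C (S k) l *
     (powerRZ (- x) (- Z.of_nat l) * lower_gamma (Z.of_nat l) x)) 1 (S k))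
    by (intros; apply Rmult_assoc).
  rewrite (sum_n_m_ext_loc _ (fun l => Binomial.C k l *
     (powerRZ (- x) (- Z.of_nat l) * lower_gamma (Z.of_nat l) x)) 1 k)
    by (intros; apply Rmult_assoc).
  rewrite sum_pascal, HS.
  rewrite lower_gamma_succ, Ropp_involutive; fold lam.
  set (G' := upper_gamma (- Z.of_nat (S k)) x) in *.
  set (G := upper_gamma (- Z.of_nat k) x) in *.
  assert (Hk : INR (S k) <> 0) by (apply not_0_INR; lia).
  replace G with (exp (- x) * (/ x) ^ S k - INR (S k) * G') by lra.
  replace ((- x) ^ S k) with ((-1) ^ S k * x ^ S k)
    by (rewrite <- Rpow_mult_distr; f_equal; ring).
  rewrite exp_Ropp, pow_inv.
  replace (S k + 1)%nat with (S (S k)) by lia; replace (k + 1)%nat with (S k) by lia.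
  assert (H1 : (-1) ^ k * (-1) ^ k = 1) by (rewrite <- Rpow_mult_distr; replace (-1 * -1) with 1 by ring; apply pow1).
  set (X := x ^ S k) in *; rewrite <- !(tech_pow_Rmult (-1)); set (s := (-1) ^ k) in *.
  set (N := INR (S k)) in *.
  (* The sign [s] is 1 or -1; in each case the goal is a rational identity. *)
  assert (Hs : (s - 1) * (s + 1) = 0) by lra.
  apply Rmult_integral in Hs; destruct Hs as [Hs|Hs];
    [replace s with 1 by lra|replace s with (-1) by lra]; field; repeat split; lra.
Qed.

(** * Convolution with the exponential series *)

(** The coefficient of [z^n] in the product of [e^z] and the power series with coefficients [u]. *)
Definition fact_conv (n : nat) (u : nat -> R) : R :=
  sum_f_R0 (fun k => u k / INR (fact (n - k))) n.

Lemma fact_conv_ext (n : nat) (u v : nat -> R) :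
  (forall k, u k = v k) -> fact_conv n u = fact_conv n v.
Proof. intros H; apply sum_eq; intros k _; rewrite H; reflexivity. Qed.

Lemma fact_conv_plus (n : nat) (u v : nat -> R) :
  fact_conv n (fun k => u k + v k) = fact_conv n u + fact_conv n v.
Proof.
  unfold fact_conv; rewrite <- plus_sum; apply sum_eq; intros k _; unfold Rdiv; ring.
Qed.

Lemma fact_conv_scal (n : nat) (a : R) (u : nat -> R) :
  fact_conv n (fun k => a * u k) = a * fact_conv n u.
Proof.
  unfold fact_conv; rewrite scal_sum; apply sum_eq; intros k _; unfold Rdiv; ring.
Qed.

Lemma fact_conv_succ (n : nat) (u : nat -> R) :
  fact_conv (S n) u = u 0%nat / INR (fact (S n)) + fact_conv n (fun k => u (S k)).
Proof. unfold fact_conv; rewrite decomp_sum by lia; reflexivity. Qed.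

(** The Leibniz rule for the product of [e^z] and the series of [u], read on coefficients. It
    follows by writing [S n] as [k + (S n - k)] in each term. *)
Lemma fact_conv_succ_mul (n : nat) (u : nat -> R) :
  INR (S n) * fact_conv (S n) u =
  fact_conv n (fun k => INR (S k) * u (S k)) + fact_conv n u.
Proof.
  transitivity (fact_conv (S n) (fun k => INR k * u k)
                + sum_f_R0 (fun k => INR (S n - k) * (u k / INR (fact (S n - k)))) (S n)).
  - unfold fact_conv; rewrite scal_sum, <- plus_sum; apply sum_eq; intros k Hk.
    rewrite minus_INR by lia; unfold Rdiv; ring.
  - rewrite fact_conv_succ, tech5, Nat.sub_diag; change (INR 0) with 0.
    unfold Rdiv at 1; rewrite !Rmult_0_l, Rplus_0_l, Rplus_0_r; f_equal.
    apply sum_eq; intros k Hk; replace (S n - k)%nat with (S (n - k)) by lia.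
    rewrite fact_simpl, mult_INR; field; split; [apply INR_fact_neq_0|].
    apply not_0_INR; lia.
Qed.

(** The classical [n! e^(-x) sum_j x^j / j!], summed in reverse order so as to appear as a
    convolution. *)
Lemma upper_gamma_nat (n : nat) (x : R) :
  0 < x ->
  upper_gamma (Z.of_nat n + 1) x =
  INR (fact n) * exp (- x) * x ^ (n + 1) * fact_conv n (fun k => (/ x) ^ S k).
Proof.
  intros Hx; induction n as [|n IH].
  - rewrite upper_gamma_succ by exact Hx; unfold fact_conv; simpl; field; lra.
  - replace (Z.of_nat (S n)) with (Z.of_nat n + 1)%Z by lia.
    rewrite upper_gamma_succ, IH, fact_conv_succ by exact Hx.
    rewrite (fact_conv_ext n (fun k => (/ x) ^ S (S k)) (fun k => / x * (/ x) ^ S k)) by reflexivity.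
    rewrite fact_conv_scal, fact_simpl, mult_INR.
    replace (Z.of_nat n + 1)%Z with (Z.of_nat (S n)) by lia.
    rewrite <- INR_IZR_INZ, <- pow_powerRZ.
    replace (S n + 1)%nat with (S (S n)) by lia; replace (n + 1)%nat with (S n) by lia.
    assert (Hn : INR (S n) <> 0) by (apply not_0_INR; lia).
    assert (Hf := INR_fact_neq_0 n).
    rewrite <- (tech_pow_Rmult x (S n)), pow_1; field; repeat split; try assumption; lra.
Qed.

(** One application of [fact_conv_succ_mul] merges neighbouring orders into powers of [/ x], whose
    convolution is known from [upper_gamma_nat]. *)
Lemma fact_conv_upper_gamma (n : nat) (x : R) :
  0 < x ->
  INR (fact n) * fact_conv n (fun k => upper_gamma (- Z.of_nat k) x) =
  (/ x) ^ n * upper_gamma (Z.of_nat n) x.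
Proof.
  intros Hx; destruct n as [|n].
  - unfold fact_conv; simpl; field.
  - rewrite fact_simpl, mult_INR, (Rmult_comm (INR (S n))), Rmult_assoc, fact_conv_succ_mul.
    rewrite <- fact_conv_plus.
    rewrite (fact_conv_ext n _ (fun k => exp (- x) * (/ x) ^ S k))
      by (intros k; apply upper_gamma_neg_succ, Hx).
    replace (Z.of_nat (S n)) with (Z.of_nat n + 1)%Z by lia.
    rewrite fact_conv_scal, upper_gamma_nat by exact Hx.
    replace (n + 1)%nat with (S n) by lia.
    rewrite pow_inv; field; apply pow_nonzero; lra.
Qed.

(** For [k >= 1], multiplying by [- e^x] gives [x^(-k) (C_k - C_(k-1))], by [brace_succ]. The value
    0 at [k = 0] leaves [A 0] uncorrected. *)
Definition upper_gamma_neg_quot (x : R) (k : nat) : R :=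
  match k with
  | 0%nat => 0
  | S j => upper_gamma (- Z.of_nat j) x / INR k
  end.

(** The decrements [e^x x^(-n) Gamma(n, x)] of [A n] are summed up as one convolution, to be
    compared with that for [J n]. *)
Lemma is_RInt_gen_one_sub_exp_quot (x : R) (n : nat) :
  0 < x ->
  is_RInt_gen (one_sub_exp_quot x n) (at_right 0) (Rbar_locally p_infty)
    (Ein x + brace x 0
     - exp x * (INR (fact n) * fact_conv n (upper_gamma_neg_quot x))).
Proof.
  intros Hx; induction n as [|n IH].
  - replace (fact_conv 0 (upper_gamma_neg_quot x)) with 0
      by (unfold fact_conv; simpl; field).
    rewrite brace_0, !Rmult_0_r, Rminus_0_r.
    apply is_RInt_gen_one_sub_exp_quot_0, Hx.
  - evar_last; [apply is_RInt_gen_one_sub_exp_quot_succ; [exact Hx|exact IH]|].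
    rewrite powerRZ_neg', <- pow_powerRZ, <- pow_inv, Rmult_assoc.
    rewrite <- fact_conv_upper_gamma by exact Hx.
    rewrite fact_simpl, mult_INR, (Rmult_comm (INR (S n))), (Rmult_assoc (INR (fact n))).
    rewrite fact_conv_succ_mul.
    rewrite (fact_conv_ext n (fun k => INR (S k) * _) (fun k => upper_gamma (- Z.of_nat k) x));
      [ring|].
    intros k; unfold upper_gamma_neg_quot; field; apply not_0_INR; lia.
Qed.

Lemma is_RInt_gen_log_integrand (x : R) (n : nat) :
  0 < x ->
  is_RInt_gen (log_integrand x n) (at_right 0) (Rbar_locally p_infty)
    (INR (fact n) * fact_conv n (fun k => (/ x) ^ S k * (Ein x + brace x k))).
Proof.
  intros Hx; assert (HA := fun n => is_RInt_gen_one_sub_exp_quot x n Hx).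
  induction n as [|n IH].
  - evar_last.
    + apply is_RInt_gen_log_integrand_step; [exact Hx| |exact (HA 0%nat)].
      (* The zero function is integrated as 0 times a convergent integral. *)
      eapply is_RInt_gen_ext_pos; [|exact (is_RInt_gen_scal _ 0 _ (HA 0%nat))].
      intros t _; transitivity 0; [apply Rmult_0_l|symmetry; apply Rmult_0_l].
    + unfold fact_conv, scal; simpl; unfold mult; simpl; field; lra.
  - evar_last.
    + apply is_RInt_gen_log_integrand_step with (j := INR (S n) * (INR (fact n)
        * fact_conv n (fun k => (/ x) ^ S k * (Ein x + brace x k))));
        [exact Hx| |exact (HA (S n))].
      exact (is_RInt_gen_scal _ (INR (S n)) _ IH).
    + rewrite !fact_conv_succ; unfold upper_gamma_neg_quot at 1.
      (* By [brace_succ], the shifted sequence is [/ x] times the original one plus the correction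
         contributed by [A (n + 1)]. *)
      rewrite (fact_conv_ext n (fun k => (/ x) ^ S (S k) * _)
        (fun k => / x * ((/ x) ^ S k * (Ein x + brace x k)
                         + - exp x * upper_gamma_neg_quot x (S k)))).
      * rewrite fact_conv_scal, fact_conv_plus, fact_conv_scal, fact_simpl, mult_INR.
        assert (Hn : INR (S n) <> 0) by (apply not_0_INR; lia).
        assert (Hf := INR_fact_neq_0 n).
        rewrite pow_1; field; repeat split; try assumption; lra.
      * intros k; unfold upper_gamma_neg_quot; rewrite <- brace_succ by exact Hx.
        rewrite <- (tech_pow_Rmult (/ x) (S k)); ring.
Qed.

(** * Identification of [I1star] with [J n], and separation of the [Ein] part *)

Theorem theorem17 (n : nat) (x : R) (hx : 0 < x) :
  I1star (INR n / 2) ((INR n + 1) / 2) x =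
  exp x * Ein x / x ^ (n + 1) * upper_gamma (Z.of_nat n + 1) x
  + INR (fact n) *
    sum_n (fun k : nat =>
      powerRZ x (- Z.of_nat k - 1) / INR (fact (n - k)) *
      ((-1) ^ (k + 1) * upper_gamma (- Z.of_nat k) x
         * lower_gamma (Z.of_nat k + 1) (- x)
       - harmonic k
       - sum_n_m (fun l : nat =>
           Binomial.C k l * powerRZ (- x) (- Z.of_nat l)
           * lower_gamma (Z.of_nat l) x) 1 k)) n.
Proof.
  transitivity (INR (fact n) * fact_conv n (fun k => (/ x) ^ S k * (Ein x + brace x k))).
  - apply (is_RInt_gen_unique (V := R_CompleteNormedModule)).
    eapply is_RInt_gen_ext_pos; [|exact (is_RInt_gen_log_integrand x n hx)].
    intros t Ht; unfold log_integrand.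
    replace ((INR n + 1) / 2 - INR n / 2 - 1 / 2) with 0 by field.
    replace ((INR n + 1) / 2 + INR n / 2 - 1 / 2) with (INR n) by field.
    rewrite Rpower_O, Rpower_pow by lra; ring.
  (* The [Ein] part is a convolution of powers of [/ x], which [upper_gamma_nat] turns into
     [Gamma(n + 1, x)]. *)
  - rewrite (fact_conv_ext n _ (fun k => Ein x * (/ x) ^ S k + (/ x) ^ S k * brace x k))
      by (intros k; ring).
    rewrite fact_conv_plus, fact_conv_scal, upper_gamma_nat, sum_n_Reals by exact hx.
    rewrite Rmult_plus_distr_l; f_equal.
    + rewrite exp_Ropp; assert (He := exp_pos x).
      field; split; [lra|apply pow_nonzero; lra].
    + f_equal; apply sum_eq; intros k _.
      replace (- Z.of_nat k - 1)%Z with (- Z.of_nat (S k))%Z by lia.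
      rewrite powerRZ_neg', <- pow_powerRZ, pow_inv; unfold brace, Rdiv; ring.
Qed.
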